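(* Let $(N,\|\cdot\|)$ be a real normed space, let $\mathcal{K}$ be the set of all cones in $N$, and let $\mathcal{A}$ be the set of all continuous functionals $\alpha:N\to\mathbb{R}$ satisfying: (1) $\alpha(u+v)\ge\alpha(u)+\alpha(v)$ for all $u,v\in N$; (2) $\alpha(\lambda u)\ge\lambda\alpha(u)$ for all $u\in N$, $\lambda\in[0,+\infty)$; (3) if $\alpha(u)\ge 0$ and $\alpha(-u)\ge 0$ then $u=0$. For $\alpha\in\mathcal{A}$ put $K_\alpha:=\{u\in N : \alpha(u)\ge 0\}$. Then $$\mathcal{K}=\{K_\alpha : \alpha\in\mathcal{A}\}.$$
   Context: A cone in a real normed space $N$ is a closed set $K\subset N$ such that: $u+v\in K$ for all $u,v\in K$; $\lambda u\in K$ for all $u\in K$ and $\lambda\in[0,+\infty)$; and $K\cap(-K)=\{0\}$. ''Functional'' means a (not necessarily linear) map $N\to\mathbb{R}$. *)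

(* Defs.v *)
From HB Require Import structures.
From mathcomp Require Import all_boot all_order all_algebra.
From mathcomp Require Import all_classical all_reals all_analysis.
Set Implicit Arguments.
Unset Strict Implicit.
Unset Printing Implicit Defensive.
Import Order.TTheory GRing.Theory Num.Theory.
Import numFieldNormedType.Exports.
Local Open Scope classical_set_scope.
Local Open Scope ring_scope.

Definition is_cone (R : realType) (N : normedModType R) (K : set N) : Prop :=
  [/\ closed K,
      forall u v : N, K u -> K v -> K (u + v),
      forall (l : R) (u : N), 0 <= l -> K u -> K (l *: u)
    & K `&` [set - u | u in K] = [set 0]].

Definition cones (R : realType) (N : normedModType R) : set (set N) :=
  [set K : set N | is_cone K].
Arguments cones {R} N.

Definition is_admissible (R : realType) (N : normedModType R)
    (alpha : N -> R) : Prop :=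
  [/\ continuous alpha,
      forall u v : N, alpha u + alpha v <= alpha (u + v),
      forall (l : R) (u : N), 0 <= l -> l * alpha u <= alpha (l *: u)
    & forall u : N, 0 <= alpha u -> 0 <= alpha (- u) -> u = 0].

Definition admissible (R : realType) (N : normedModType R) : set (N -> R) :=
  [set alpha : N -> R | is_admissible alpha].
Arguments admissible {R} N.

Definition nonneg_set (R : realType) (N : normedModType R)
    (alpha : N -> R) : set N :=
  [set u : N | 0 <= alpha u].

(* Main.v *)
Require Import Defs.
From HB Require Import structures.
From mathcomp Require Import all_boot all_order all_algebra.
From mathcomp Require Import all_classical all_reals all_analysis.
Set Implicit Arguments.
Unset Strict Implicit.
Unset Printing Implicit Defensive.
Import Order.TTheory GRing.Theory Num.Theory.
Import numFieldNormedType.Exports.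
Local Open Scope classical_set_scope.
Local Open Scope ring_scope.

(** A cone [K] is the nonnegativity set of [alpha u = - d(u, K)]: the cone
axioms make the distance to [K] sublinear, and since [K] is closed, the
distance vanishes exactly on [K]. *)

Section SetDistance.
Context {R : realType} {N : normedModType R}.
Implicit Types (K : set N) (u v k : N).

(** Each cone axiom mirrors a property of the distance [d] to [K]. Stability under addition and
    scaling makes [- d] superadditive and superhomogeneous ([set_dist_subadditive], [set_distZ_le]);
    [d] is 1-Lipschitz; closedness gives [d u <= 0] only on [K] ([set_dist_closed]); then [K]
    meeting [-K] only at [0] is condition (3). Conversely, the cone axioms for [nonneg_set alpha]
    are read off from admissibility once [alpha 0 = 0] is known. *)

Definition set_dist K u : R := inf [set `|u - k| | k in K].

Lemma set_dist_le K u k : K k -> set_dist K u <= `|u - k|.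
Proof.
move=> Kk; apply: ge_inf; last by exists k.
by exists 0 => _ [x _ <-].
Qed.

(** Nonemptiness matters: [inf] of the empty set is [0] by default. *)
Lemma le_set_dist K u (m : R) : K !=set0 ->
  (forall k, K k -> m <= `|u - k|) -> m <= set_dist K u.
Proof.
move=> [k0 Kk0] mK; apply: lb_le_inf; first by exists `|u - k0|, k0.
by move=> _ [k Kk <-]; exact: mK.
Qed.

Lemma set_dist_lipschitz K u v : K !=set0 ->
  set_dist K u <= `|u - v| + set_dist K v.
Proof.
move=> K0; rewrite -lerBlDl; apply: le_set_dist => // k Kk.
by rewrite lerBlDl (le_trans (set_dist_le u Kk))// ler_distD.
Qed.

Lemma continuous_set_dist K : K !=set0 -> continuous (set_dist K).
Proof.
move=> K0 u; apply/cvgrPdist_lt => e e0; near=> v.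
apply: (@le_lt_trans _ _ `|u - v|).
  (* The two halves of the absolute value are the Lipschitz bound for [u], [v] and for [v], [u]. *)
  rewrite ler_norml lerBlDr set_dist_lipschitz// andbT lerBrDr addrC lerBlDr.
  by rewrite distrC addrC set_dist_lipschitz.
by near: v; apply: cvgr_dist_lt.
Unshelve. all: by end_near. Qed.

(** A ball of radius [e] around [u] missing [K] would force [e <= set_dist K u], so [u] is in the
    closure of [K]. *)
Lemma set_dist_closed K u : closed K -> K !=set0 -> set_dist K u <= 0 -> K u.
Proof.
move=> cK K0 du; apply: cK => B /nbhs_ballP[e /= e0 eB].
apply: contrapT => BK; suff : e <= set_dist K u.
  by rewrite leNgt (le_lt_trans du).
apply: le_set_dist => // k Kk; rewrite leNgt; apply/negP => uk.
by apply: BK; exists k; split=> //; apply: eB; rewrite -ball_normE.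
Qed.

(** For [k], [l] in [K], the point [k + l] competes in the infimum for [u + v]; the infima over [k]
    and [l] are taken in turn. *)
Lemma set_dist_subadditive K u v : K !=set0 ->
  (forall x y, K x -> K y -> K (x + y)) ->
  set_dist K (u + v) <= set_dist K u + set_dist K v.
Proof.
move=> K0 KD; rewrite -lerBlDr; apply: le_set_dist => // k Kk.
rewrite lerBlDr -lerBlDl; apply: le_set_dist => // l Kl.
rewrite lerBlDl (le_trans (set_dist_le _ (KD _ _ Kk Kl)))//.
by rewrite opprD addrACA ler_normD.
Qed.

Lemma set_distZ_le K (l : R) u : 0 <= l -> K !=set0 ->
  (forall x, K x -> K (l *: x)) -> set_dist K (l *: u) <= l * set_dist K u.
Proof.
move=> l0 K0 KZ.
have dZ k : K k -> set_dist K (l *: u) <= l * `|u - k|.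
  by move=> /KZ/(set_dist_le (l *: u)); rewrite -scalerBr normrZ ger0_norm.
(* The case [l = 0] is separate because the other one divides by [l]; there [dZ] at any point of [K]
   is already the bound by [0]. *)
move: l0; rewrite le_eqVlt => /predU1P[l0|l0].
  by case: K0 => k /dZ; rewrite -l0 !mul0r.
by rewrite -ler_pdivrMl//; apply: le_set_dist => // k /dZ; rewrite ler_pdivrMl.
Qed.

End SetDistance.

(** Superadditivity at [0 + 0] gives [alpha 0 <= 0]; scaling by [0] gives the reverse. This puts [0]
    in [nonneg_set alpha]. *)
Lemma admissible0 (R : realType) (N : normedModType R) (alpha : N -> R) :
  is_admissible alpha -> alpha 0 = 0.
Proof.
move=> [_ aD aZ _]; apply/eqP; rewrite eq_le; apply/andP; split.
  by have := aD 0 0; rewrite addr0 gerDl.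
by have := aZ 0 0 (lexx _); rewrite mul0r scale0r.
Qed.

Lemma nonneg_set_cone (R : realType) (N : normedModType R) (alpha : N -> R) :
  is_admissible alpha -> is_cone (nonneg_set alpha).
Proof.
move=> adm; have a0 := admissible0 adm; case: adm => ac aD aZ aN; split.
- exact: (preimage_closed (fun x _ => ac x) (@closed_ge R 0)).
- by move=> u v au av; exact: le_trans (addr_ge0 au av) (aD u v).
- by move=> l u l0 au; exact: le_trans (mulr_ge0 l0 au) (aZ l u l0).
- apply/seteqP; split=> [x [ax [y ay yx]]|_ ->] /=.
    by apply: aN => //; rewrite -yx opprK.
  by rewrite /nonneg_set /= a0; split=> //; exists 0; rewrite ?oppr0 ?a0.
Qed.

(** Supplies the nonemptiness that the distance lemmas require. *)
Lemma cone0 (R : realType) (N : normedModType R) (K : set N) :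
  is_cone K -> K 0.
Proof. by case=> _ _ _ KN; have [] : (K `&` [set - u | u in K]) 0 by rewrite KN. Qed.

Lemma nonneg_set_oppr_set_dist (R : realType) (N : normedModType R)
    (K : set N) :
  is_cone K -> nonneg_set (fun u => - set_dist K u) = K.
Proof.
move=> cK; have K0 : K !=set0 by exists 0; exact: cone0.
case: cK => cK _ _ _; apply/seteqP; split=> u; rewrite /nonneg_set /= oppr_ge0.
  exact: set_dist_closed.
by move=> /(set_dist_le u); rewrite subrr normr0.
Qed.

Lemma oppr_set_dist_admissible (R : realType) (N : normedModType R)
    (K : set N) :
  is_cone K -> is_admissible (fun u => - set_dist K u).
Proof.
move=> coneK; have K0 : K !=set0 by exists 0; exact: cone0.
have KE := nonneg_set_oppr_set_dist coneK; case: coneK => cK KD KZ KN; split.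
- by move=> u; apply: cvgN; exact: continuous_set_dist.
- by move=> u v; rewrite -opprD lerN2 set_dist_subadditive.
- move=> l u l0; rewrite mulrN lerN2 set_distZ_le// => x; exact: KZ.
(* Through [KE], [du] and [dNu] say that [u] and [- u] lie in [K]. *)
- move=> u du dNu; suff : (K `&` [set - u | u in K]) u by rewrite KN.
  rewrite -KE; split=> //; exists (- u) => //; exact: opprK.
Qed.

Theorem theorem2p4 (R : realType) (N : normedModType R) :
  cones N = [set nonneg_set alpha | alpha in admissible N].
Proof.
apply/seteqP; split=> [K cK|_ [alpha adm <-]]; last exact: nonneg_set_cone.
exists (fun u => - set_dist K u); first exact: oppr_set_dist_admissible.
exact: nonneg_set_oppr_set_dist.
Qed.
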